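(* Let $G=(V,E,W)$ be a road network, let $k$ be a positive integer, let $q\in V$ be a query point and let $v\in V$ be a vertex. Suppose that $v$ is a reverse $k$-nearest neighbor of $q$, and let $v'\in V$ with $v'\neq v$ be a vertex such that the shortest path from $v'$ to $q$ passes through $v$. If $v'$ is a reverse $k$-nearest neighbor of $q$, then $v$ is one of the $k$-nearest neighbors of $v'$, i.e. $v\in kNN(v')$.
   Context: A road network $G=(V,E,W)$ is an undirected graph with vertex set $V$, edge set $E$, and a function $W$ assigning to each edge $e$ a positive weight $w(e)$ (the length of the road segment). For $x,y\in V$, $SD(x,y)$ denotes the shortest path distance in $G$, i.e. the minimum total weight of a path between $x$ and $y$. ''The shortest path from $v'$ to $q$ passes through $v$'' means that there is a path from $v'$ to $q$ of total weight $SD(v',q)$ containing $v$; in particular $SD(v',q)=SD(v',v)+SD(v,q)$. All vertices are treated as points of interest (facilities), so nearest neighbors of a vertex are taken among the vertices of $V$. For a vertex $x\in V$ and a positive integer $k\le |V|$, $kNN(x)$ denotes the result of the $k$-nearest neighbor query at $x$: a set $kNN(x)\subseteq V$ with (1) $|kNN(x)|=k$ and (2) $SD(x,y')\le SD(x,y'')$ for all $y'\in kNN(x)$ and all $y''\in V\setminus kNN(x)$. If ties make such a set non-unique, one such set is fixed for each $x$. The elements of $kNN(x)$ are called the $k$-nearest neighbors of $x$. A vertex $x$ is a reverse $k$-nearest neighbor (R$k$NN) of $q$ if $q\in kNN(x)$. *)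

(* Defs.v *)
From HB Require Import structures.
From mathcomp Require Import all_boot all_order all_algebra.
From mathcomp Require Import reals constructive_ereal.

Set Implicit Arguments.
Unset Strict Implicit.
Unset Printing Implicit Defensive.

Import Order.TTheory GRing.Theory Num.Theory.

Local Open Scope ring_scope.

(* The weight w(e) of an edge e = {x, y} is [weight x y]; the values of
   [weight] outside [edge] are irrelevant.  Connectedness is not assumed. *)
Record road_network (R : realType) (V : finType) := RoadNetwork {
  edge : rel V;
  weight : V -> V -> R;
  edge_sym : symmetric edge;
  edge_irr : irreflexive edge;
  weight_sym : forall x y, edge x y -> weight x y = weight y x;
  weight_gt0 : forall x y, edge x y -> 0 < weight x y
}.

Section RoadNetwork.
Variables (R : realType) (V : finType) (G : road_network R V).

(* As in mathcomp's [path], the vertices of the path are [x :: p]. *)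
Definition is_path (x y : V) (p : seq V) : bool :=
  [&& path (edge G) x p, last x p == y & uniq (x :: p)].

Fixpoint path_weight (x : V) (p : seq V) : R :=
  if p is y :: p' then weight G x y + path_weight y p' else 0.

(* The minimum ranges over all paths from [x] to [y]: a repetition-free
   [x :: p] has at most #|V| vertices.  It is +oo if there is no such path. *)
Definition SD (x y : V) : \bar R :=
  \big[Order.min/+oo%E]_(p : {bseq #|V| of V} | is_path x y p)
    (path_weight x p)%:E.

Definition shortest_path_through (x y z : V) : Prop :=
  exists p : seq V,
    [/\ is_path x y p, (path_weight x p)%:E = SD x y & z \in x :: p].

Definition is_kNN (k : nat) (x : V) (A : {set V}) : Prop :=
  #|A| = k /\
  forall y' y'' : V, y' \in A -> y'' \notin A -> (SD x y' <= SD x y'')%E.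

End RoadNetwork.

(* A family [kNN] of query results is a parameter, to account for ties. *)
Definition is_RkNN (V : finType) (kNN : V -> {set V}) (q x : V) : Prop :=
  q \in kNN x.

(* Main.v *)
(* If v is not in kNN(v') then SD(v',q) <= SD(v',v), because q is in kNN(v').
   On a shortest path from v' to q through v this forces the part from v to q
   to have weight 0; weights being positive, that part is empty and v = q. *)
Require Import Defs.
From mathcomp Require Import all_boot all_order all_algebra.
From mathcomp Require Import reals constructive_ereal.

Set Implicit Arguments.
Unset Strict Implicit.
Unset Printing Implicit Defensive.

Import Order.TTheory GRing.Theory Num.Theory.

Section RoadNetworkPaths.
Context {R : realType} {V : finType}.
Variable G : road_network R V.
Local Open Scope ring_scope.

Lemma path_weight_cat (x : V) (p1 p2 : seq V) :
  path_weight G x (p1 ++ p2) = path_weight G x p1 + path_weight G (last x p1) p2.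
Proof.
elim: p1 x => [|y p1 IH] x /=; first by rewrite add0r.
by rewrite IH addrA.
Qed.

Lemma path_weight_ge0 (x : V) (p : seq V) :
  path (edge G) x p -> 0 <= path_weight G x p.
Proof.
elim: p x => [|y p IH] x //= /andP[exy /IH p_ge0].
by rewrite addr_ge0 // ltW // weight_gt0.
Qed.

(** A first edge would contribute a strictly positive weight, and the rest of the path cannot
    compensate for it. *)
Lemma path_weight_le0_nil (x : V) (p : seq V) :
  path (edge G) x p -> path_weight G x p <= 0 -> p = [::].
Proof.
case: p => [|y p] //= /andP[exy /path_weight_ge0 p_ge0].
by rewrite leNgt ltr_pwDl // weight_gt0.
Qed.

Lemma SD_le_path_weight (x y : V) (p : seq V) :
  is_path G x y p -> (SD G x y <= (path_weight G x p)%:E)%E.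
Proof.
move=> xyp; have [_ _ Up] := and3P xyp.
have size_p : (size p <= #|V|)%N.
  (* The strict bound on [size p] is the count of the distinct vertices [x :: p], start included. *)
  by apply: ltnW; rewrite -[X in (X <= _)%N]/(size (x :: p)) -(card_uniqP Up) max_card.
exact: (bigmin_inf (Bseq size_p)).
Qed.

Lemma is_path_catl (x y : V) (p1 p2 : seq V) :
  is_path G x y (p1 ++ p2) -> is_path G x (last x p1) p1.
Proof.
by rewrite /is_path eqxx cat_path -cat_cons cat_uniq => /and3P[/andP[-> _] _ /andP[->]].
Qed.

End RoadNetworkPaths.

Theorem lemma5p1 (R : realType) (V : finType) (G : road_network R V)
    (k : nat) (k_gt0 : (0 < k)%N) (k_le : (k <= #|V|)%N)
    (kNN : V -> {set V}) (kNN_spec : forall x : V, is_kNN G k x (kNN x))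
    (q v v' : V) :
  is_RkNN kNN q v ->
  v' != v ->
  shortest_path_through G v' q v ->
  is_RkNN kNN q v' ->
  v \in kNN v'.
Proof.
move=> _ _ [p [path_p p_min v_p]] q_v'.
apply/negPn/negP => vN; have [_ /(_ q v q_v' vN)] := kNN_spec v'.
rewrite -p_min; case/splitPl: v_p path_p {p_min} => p1 p2 p1v path_p.
have := is_path_catl path_p; rewrite p1v => /SD_le_path_weight SD_p1.
(* The chain w([p1]) + w([p2]) = SD(v', q) <= SD(v', v) <= w([p1]) ends in a real number, so w([p1])
   cancels. *)
move=> /le_trans/(_ SD_p1); rewrite lee_fin path_weight_cat p1v gerDl => p2_le0.
case/and3P: path_p; rewrite cat_path last_cat p1v => /andP[_ path_p2].
(* With [p2] empty, the endpoint condition of the path reads [v == q]. *)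
rewrite (path_weight_le0_nil path_p2 p2_le0) /= => /eqP vq _.
by move: vN; rewrite vq; case/negP.
Qed.
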